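(* Fix $\varepsilon>0$ and let $\delta>1/2$ satisfy $H(\delta)=2\delta-1$ (so $\delta\approx 0.8295$), where $H$ is the binary entropy function. Let $p=p(n)\in[0,1]$, let $P_p$ be the random $0/1$ polytope in $\mathbb{R}^n$ with parameter $p$, and let $G_p$ be its graph. Then: (1) If $p(n)\le\left((1-\varepsilon)2^{-\delta}\right)^n$ for all $n\ge 1$, then with high probability $G_p$ is a clique. (2) If $p(n)\ge\left((1+\varepsilon)2^{-\delta}\right)^n$ for all $n\ge 1$, then with high probability $G_p$ is not a clique.
   Context: $H(t)=-t\log_2 t-(1-t)\log_2(1-t)$ is the binary entropy function on $[0,1]$ (with $0\log_2 0=0$). For $n\ge 1$ and $p\in[0,1]$, $Q_p^n\subseteq\{0,1\}^n$ is the random subset obtained by including each point of $\{0,1\}^n$ independently with probability $p$. The random $0/1$ polytope is $P_p=\operatorname{conv}(Q_p^n)\subset\mathbb{R}^n$. The graph ($1$-skeleton) $G_p$ of $P_p$ is the undirected graph with vertex set $Q_p^n$ (the vertices of $P_p$) in which two distinct vertices $x,y$ are adjacent if and only if the segment $[x,y]$ is a $1$-dimensional face of $P_p$; a face is the intersection of the polytope with a supporting hyperplane (or the polytope itself). A graph is a clique if every two distinct vertices are adjacent (in particular graphs with at most one vertex are cliques). ''With high probability'' means with probability tending to $1$ as $n\to\infty$. *)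

(* Defs.v *)
From HB Require Import structures.
From mathcomp Require Import all_boot all_order all_algebra.
From mathcomp Require Import all_classical all_reals all_analysis.

Set Implicit Arguments.
Unset Strict Implicit.
Unset Printing Implicit Defensive.

Import Order.TTheory GRing.Theory Num.Theory.
Import numFieldNormedType.Exports.

Local Open Scope classical_set_scope.
Local Open Scope ring_scope.

Definition log2 (R : realType) (t : R) : R := ln t / ln 2.

(* The convention 0 log 0 = 0 holds because [ln] is real-valued at 0. *)
Definition entropy (R : realType) (t : R) : R :=
  - t * log2 t - (1 - t) * log2 (1 - t).

Definition cube (n : nat) : finType := 'rV[bool]_n.

Definition cube_pt (R : realType) (n : nat) (x : cube n) : 'rV[R]_n :=
  map_mx (fun b : bool => b%:R) x.

Definition dot (R : realType) (n : nat) (c x : 'rV[R]_n) : R :=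
  \sum_(i < n) c 0 i * x 0 i.

Definition conv_hull (R : realType) (n : nat) (S : set 'rV[R]_n) :
    set 'rV[R]_n :=
  smallest (@convex_set R 'rV[R]_n) S.

Definition segment (R : realType) (n : nat) (u v : 'rV[R]_n) :
    set 'rV[R]_n :=
  [set (1 - t) *: u + t *: v | t in `[0, 1]].

Definition polytope (R : realType) (n : nat) (A : {set cube n}) :
    set 'rV[R]_n :=
  conv_hull [set cube_pt R x | x in [set` A]].

Definition hyperplane (R : realType) (n : nat) (c : 'rV[R]_n) (b : R) :
    set 'rV[R]_n :=
  [set u | dot c u = b].

Definition supporting (R : realType) (n : nat) (P : set 'rV[R]_n)
    (c : 'rV[R]_n) (b : R) : Prop :=
  [/\ c != 0, (forall u, P u -> dot c u <= b) & P `&` hyperplane c b !=set0].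

Definition is_face (R : realType) (n : nat) (P F : set 'rV[R]_n) : Prop :=
  F = P \/ exists c b, supporting P c b /\ F = P `&` hyperplane c b.

(* Dimension 1 need not be required separately: the segment joining two
   distinct points is 1-dimensional. *)
Definition skeleton_adj (R : realType) (n : nat) (A : {set cube n})
    (x y : cube n) : Prop :=
  [/\ x \in A, y \in A, x != y &
      is_face (polytope A) (segment (cube_pt R x) (cube_pt R y))].

Definition is_clique (R : realType) (n : nat) (A : {set cube n}) : Prop :=
  forall x y, x \in A -> y \in A -> x != y -> skeleton_adj R A x y.

(* Law of the random subset: the product over the points of the cube of
   Bernoulli laws of parameter [p]. *)
Definition mass (R : realType) (n : nat) (p : R) (A : {set cube n}) : R :=
  \prod_(x : cube n) (if x \in A then p else 1 - p).

Definition Pr (R : realType) (n : nat) (p : R) (E : set {set cube n}) : R :=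
  \sum_(A : {set cube n} | `[< E A >]) mass p A.

(* Main.v *)
Require Import Defs.
From HB Require Import structures.
From mathcomp Require Import all_boot all_order all_algebra.
From mathcomp Require Import all_classical all_reals all_analysis.
From mathcomp Require Import ring lra zify.

Import Order.TTheory GRing.Theory Num.Theory.
Import numFieldNormedType.Exports.

Local Open Scope classical_set_scope.
Local Open Scope ring_scope.

Set Implicit Arguments.
Unset Strict Implicit.
Unset Printing Implicit Defensive.

(** Write [d] for the Hamming distance of [x] and [y], and call subcube of
[x] and [y] the smallest face of the cube containing both. Everything rests
on which points of the random set lie in that subcube, and on one identity for
the threshold: with [r = delta / (1 - delta)] and [q = 2 ^ - delta], the
equation [H(delta) = 2 delta - 1] says exactly
[2 (1 + r) q^2 r^(-delta) = 1] ([threshold_identity]).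

Below the threshold. A functional that is constant outside the subcube up to a
large penalty reduces adjacency of [x] and [y] to the subcube, where one needs
weights on the differing coordinates with sum zero whose partial sums over
[diff x z] are negative for all other selected [z]. Such weights exist as soon
as the subcube contains at most two other selected points and these are not
antipodal in it ([nonadjacent_obstruction]). So a nonadjacent pair is either
crowded (at least three further points in its subcube) or has an antipodal pair
inside. The probability that [x, y] is a crowded pair is at most [p^2] and, by
the union bound over the three points, at most [p^5 8^d]. For [s = log2 r],
which lies between 0 and 3, the minimum of the two is at most [p^2 (p 2^d)^s],
and the sum of this over all pairs is [p^(2 + s) (2 (1 + r))^n]. Since
[q^s = r^(-delta)], the identity says that this would be 1 at [p = q^n], and
the factor [1 - eps] makes it decay. Antipodal pairs contribute at most
[(6 q^4)^n], and [6 q^4 < 1] ([first_moment_le]).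

Above the threshold. Let [d] be the index of a largest term of the
binomial expansion of [(1 + r)^n], so that [d] is within one of [(n + 1) delta]
([binomial_peak]). The identity then makes the expected number of selected
pairs at distance [d] exponentially large, and the second moment method yields
such a pair ([Pr_no_far_pair]). On the other hand, with high probability no
selected pair at distance [d] is adjacent: if [x] and [y] are adjacent, the supporting hyperplane passes through
the centre of their subcube, hence one of its closed sides contains at least
half of the [2^d] points, and none of these other than [x, y] is selected
([adj_halfspace]). For one halfspace this has probability about
[exp (- p 2^d / 2)], doubly exponentially small, while there are only
[2^O(n^2)] ways in which a halfspace can cut the cube
([card_halfspace_traces]), so that a union bound applies ([Pr_far_adj]). *)

(** * Differing coordinates and subcubes *)

Section Cube.
Context {n : nat}.
Implicit Types (x y z : cube n) (D : {set 'I_n}).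

Definition diff x y : {set 'I_n} := [set i | x 0 i != y 0 i].

Definition flip x D : cube n := \row_i (x 0 i (+) (i \in D)).

Definition subcube x y : {set cube n} := [set z | diff x z \subset diff x y].

Definition inner (A : {set cube n}) x y : {set cube n} :=
  [set z | [&& z \in A, z \in subcube x y, z != x & z != y]].

(** The reflection of [z] in the centre of [subcube x y]. *)
Definition antipode x y z : cube n := flip x (diff x y :\: diff x z).

Lemma flip_diff x y : flip x (diff x y) = y.
Proof.
apply/rowP => i; rewrite mxE inE.
by case: (x 0 i); case: (y 0 i).
Qed.

Lemma diff_flip x D : diff x (flip x D) = D.
Proof.
apply/setP => i; rewrite inE mxE.
by case: (x 0 i); case: (i \in D).
Qed.

Lemma diff_inj x : injective (diff x).
Proof. exact: can_inj (flip_diff x). Qed.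

Lemma diffxx x : diff x x = finset.set0.
Proof. by apply/setP => i; rewrite !inE eqxx. Qed.

Lemma diff_eq0 x y : (diff x y == finset.set0) = (x == y).
Proof. by rewrite -(inj_eq (diff_inj (x := x))) diffxx eq_sym. Qed.

(** Recording only where a point differs from [x] identifies the cube with the
family of subsets of the coordinates, which turns counting points into counting
subsets. *)
Lemma big_flip (V : nmodType) (F : cube n -> V) (P : pred (cube n)) x :
  \sum_(y : cube n | P y) F y = \sum_(D : {set 'I_n} | P (flip x D)) F (flip x D).
Proof.
apply: (reindex (flip x)).
by exists (diff x) => ? _; [exact: diff_flip|exact: flip_diff].
Qed.

Lemma card_flip (P : pred (cube n)) x :
  #|[set y : cube n | P y]%SET| = #|[set D : {set 'I_n} | P (flip x D)]%SET|.
Proof. by rewrite -!sum1dep_card (big_flip _ _ x). Qed.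

Lemma card_subcube x y : #|subcube x y| = (2 ^ #|diff x y|)%N.
Proof.
rewrite (card_flip _ x) -card_powerset; apply: eq_card => D.
by rewrite !inE diff_flip.
Qed.

Lemma card_sphere x d : #|[set y | #|diff x y| == d]%SET| = 'C(n, d).
Proof.
rewrite (card_flip _ x) -[n in RHS]card_ord -card_draws.
by apply: eq_card => D; rewrite !inE diff_flip.
Qed.

Lemma sum_dist (R : pzRingType) (F : nat -> R) x :
  \sum_(y : cube n) F #|diff x y| = \sum_(d < n.+1) 'C(n, d)%:R * F d.
Proof.
have lt_d y : (#|diff x y| < n.+1)%N by rewrite ltnS -[n in X in (_ <= X)%N]card_ord max_card.
rewrite (partition_big (fun y => Ordinal (lt_d y)) predT) //=.
apply: eq_bigr => d _; rewrite -(card_sphere x) -sum1dep_card natr_sum mulr_suml.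
by apply: eq_big => [y|y /eqP <-] //=; rewrite mul1r.
Qed.

Lemma sum_dist_pow (R : comPzRingType) (r : R) x :
  \sum_(y : cube n) r ^+ #|diff x y| = (1 + r) ^+ n.
Proof.
rewrite (sum_dist (fun d => r ^+ d)) exprDn.
by apply: eq_bigr => d _; rewrite expr1n mul1r mulr_natl.
Qed.

End Cube.

(** * Edges of the polytope and linear functionals *)

Section Geometry.
Context {R : realType} {n : nat}.
Implicit Types (x y z : cube n) (A : {set cube n}) (u v c : 'rV[R]_n) (b t : R).

Local Notation pt := (@cube_pt R n).

Lemma dot_conv c u v t :
  dot c ((1 - t) *: u + t *: v) = (1 - t) * dot c u + t * dot c v.
Proof.
rewrite /dot !mulr_sumr -big_split /=; apply: eq_bigr => i _.
by rewrite !mxE; ring.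
Qed.

Lemma convex_setP (S : set 'rV[R]_n) :
  convex_set S <-> (forall u v t, S u -> S v -> 0 < t -> t < 1 ->
                     S ((1 - t) *: u + t *: v)).
Proof.
split => [cS u v t Su Sv t0 t1|cS].
  have t01 : 0 <= t <= 1 by rewrite !ltW.
  have := cS v u (Itv01 (ltW t0) (ltW t1)) (mem_set Sv) (mem_set Su).
  by rewrite inE /conv /= addrC.
apply/convex_setW => u v /set_mem Su /set_mem Sv k k0 k1.
by apply/mem_set; rewrite /conv /= addrC; apply: cS.
Qed.

Lemma convex_segment u v : convex_set (segment u v).
Proof.
apply/convex_setP => _ _ t [a + <-] [b + <-] t0 t1.
rewrite /= !in_itv /= => /andP[a0 a1] /andP[b0 b1].
exists ((1 - t) * a + t * b); first by rewrite /= in_itv /=; nra.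
by apply/rowP => i; rewrite !mxE; ring.
Qed.

Lemma segment_left u v : segment u v u.
Proof.
exists 0; first by rewrite /= in_itv /= lexx ler01.
by rewrite subr0 scale1r scale0r addr0.
Qed.

Lemma segment_right u v : segment u v v.
Proof.
exists 1; first by rewrite /= in_itv /= lexx ler01.
by rewrite subrr scale0r scale1r add0r.
Qed.

Lemma polytope_pt A x : x \in A -> polytope A (pt x).
Proof. by move=> xA S [cS]; apply; exists x. Qed.

Lemma polytope_min A (S : set 'rV[R]_n) :
  convex_set S -> (forall x, x \in A -> S (pt x)) -> polytope A `<=` S.
Proof. by move=> cS AS u; apply; split=> // _ [x xA <-]; exact: AS. Qed.

Lemma convex_polytope A : convex_set (polytope A : set 'rV[R]_n).
Proof.
apply/convex_setP => u v t Pu Pv t0 t1 S SA; have [cS _] := SA.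
by move/convex_setP: cS; apply=> //; [exact: Pu|exact: Pv].
Qed.

(** The parameter of a 0/1 point on the segment is 0 or 1, as one sees on any
coordinate where the endpoints differ. *)
Lemma cube_pt_segment x y z :
  segment (pt x) (pt y) (pt z) -> (z == x) || (z == y).
Proof.
move=> [t _ /rowP tz].
have {}tz i : (1 - t) * (x 0 i)%:R + t * (y 0 i)%:R = (z 0 i)%:R :> R.
  by have := tz i; rewrite !mxE.
have bE (a b : bool) : a%:R = b%:R :> R -> a = b.
  by case: a; case: b => // /eqP; rewrite ?oner_eq0 // eq_sym oner_eq0.
have [xy|xy] := eqVneq x y.
  apply/orP; left; apply/eqP/rowP => i; apply: bE.
  by rewrite -tz xy; ring.
have [i xyi] : exists i, x 0 i != y 0 i.
  apply/existsP; rewrite -[X in is_true X]negbK negb_exists; apply: contra xy.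
  by move=> /forallP xy; apply/eqP/rowP => i; apply/eqP; rewrite -[_ == _]negbK.
have t01 : (t == 0) || (t == 1).
  move: (tz i) xyi; case: (x 0 i); case: (y 0 i) => //; case: (z 0 i) => /=;
  rewrite ?mulr1 ?mulr0 ?addr0 ?add0r.
  - by move=> /eqP; rewrite subr_eq addrC -subr_eq subrr eq_sym => ->.
  - by move=> /eqP; rewrite subr_eq0 eq_sym => ->; rewrite orbT.
  - by move=> ->; rewrite eqxx orbT.
  - by move=> ->; rewrite eqxx.
apply/orP; case/orP: t01 tz => /eqP -> tz; [left|right];
  by apply/eqP/rowP => j; apply: bE; rewrite -tz; ring.
Qed.

(** The strict lower side of the hyperplane together with the segment is a convex
set containing all the vertices, hence the polytope; this avoids any explicit
convex combination. The functional may vanish (then [A] is [{x, y}]): this is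
the case in which the face is the whole polytope. *)
Lemma exposed_segment_adj A x y c b :
  x \in A -> y \in A -> x != y -> dot c (pt x) = b -> dot c (pt y) = b ->
  (forall z, z \in A -> z != x -> z != y -> dot c (pt z) < b) ->
  skeleton_adj R A x y.
Proof.
move=> xA yA xy cx cy cA; split=> //.
have PE : segment (pt x) (pt y) = polytope A `&` hyperplane c b.
  apply/seteqP; split => [u xyu|u [Pu cu]].
    split.
      case: xyu => t /=; rewrite in_itv /= => /andP[t0 t1] <-.
      have [->|tn0] := eqVneq t 0.
        by rewrite subr0 scale1r scale0r addr0; exact: polytope_pt.
      have [->|tn1] := eqVneq t 1.
        by rewrite subrr scale0r scale1r add0r; exact: polytope_pt.
      have /convex_setP := convex_polytope (A := A); apply.
      - exact: polytope_pt.
      - exact: polytope_pt.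
      - by rewrite lt_neqAle eq_sym tn0.
      - by rewrite lt_neqAle tn1.
    by case: xyu => t _ <-; rewrite /hyperplane /= dot_conv cx cy; ring.
  have cvS : convex_set [set u | dot c u < b \/ segment (pt x) (pt y) u].
    have seg_b v : segment (pt x) (pt y) v -> dot c v = b.
      by move=> [t _ <-]; rewrite dot_conv cx cy; ring.
    have seg_le v : dot c v < b \/ segment (pt x) (pt y) v -> dot c v <= b.
      by case=> [/ltW//|/seg_b ->].
    apply/convex_setP => v w t /= Sv Sw t0 t1; rewrite dot_conv.
    case: Sv => [vb|sv]; last case: Sw => [wb|sw].
    - left; have := seg_le _ Sw; nra.
    - left; rewrite (seg_b _ sv); nra.
    - by right; move/convex_setP: (convex_segment (u := pt x) (v := pt y)); apply.
  have : dot c u < b \/ segment (pt x) (pt y) u.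
    apply: (polytope_min cvS _ Pu) => z zA /=.
    have [->|zx] := eqVneq z x; first by right; exact: segment_left.
    have [->|zy] := eqVneq z y; first by right; exact: segment_right.
    by left; exact: cA.
  by case=> [|//]; rewrite cu ltxx.
have [c0|cn0] := eqVneq c 0; [left|right].
  rewrite PE; apply/seteqP; split=> [u []//|u Pu]; split=> //.
  have dot0 v : dot c v = 0 by rewrite /dot big1 // => i _; rewrite c0 mxE mul0r.
  by rewrite /hyperplane /= dot0 -cx dot0.
exists c, b; split=> //; split=> //.
  move=> u Pu; apply: (polytope_min (S := [set u | dot c u <= b]) _ _ Pu) => [|z zA] /=.
    by apply/convex_setP => v w t /= vb wb t0 t1; rewrite dot_conv; nra.
  have [->|zx] := eqVneq z x; first by rewrite cx.
  have [->|zy] := eqVneq z y; first by rewrite cy.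
  exact/ltW/cA.
by exists (pt x); split=> //; exact: polytope_pt.
Qed.

(** If the segment is the whole polytope, then [A] has no point other than [x] and
[y], and the zero functional satisfies the conclusion. *)
Lemma adj_exposed_segment A x y :
  skeleton_adj R A x y ->
  exists c b, [/\ dot c (pt x) = b, dot c (pt y) = b &
    forall z, z \in A -> z != x -> z != y -> dot c (pt z) < b].
Proof.
move=> [xA yA xy [PE|[c [b [[_ cP _] PE]]]]].
  exists 0, 0; have dot0 v : dot 0 v = 0 :> R.
    by rewrite /dot big1 // => i _; rewrite mxE mul0r.
  split=> // z zA zx zy.
  have /cube_pt_segment : segment (pt x) (pt y) (pt z) by rewrite PE; exact: polytope_pt.
  by rewrite (negbTE zx) (negbTE zy).
exists c, b; split.
- by have := segment_left (pt x) (pt y); rewrite PE => -[].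
- by have := segment_right (pt x) (pt y); rewrite PE => -[].
- move=> z zA zx zy; rewrite lt_neqAle cP ?andbT; last exact: polytope_pt.
  apply/negP => /eqP cz.
  have /cube_pt_segment : segment (pt x) (pt y) (pt z).
    by rewrite PE; split=> //; exact: polytope_pt.
  by rewrite (negbTE zx) (negbTE zy).
Qed.

(** The indicator of [x 0 i != z 0 i] is an affine function of [z 0 i], so
functionals may be given by weights on the coordinates that differ from
[x]. *)
Lemma weight_dot x (w : 'I_n -> R) :
  exists c b, forall z, dot c (pt z) = b + \sum_(i in diff x z) w i.
Proof.
exists (\row_i (if x 0 i then - w i else w i)), (- \sum_(i | x 0 i) w i) => z.
rewrite /dot -sumrN [X in _ = X + _]big_mkcond [X in _ = _ + X]big_mkcond -big_split /=.
apply: eq_bigr => i _; rewrite !mxE inE.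
by case: (x 0 i); case: (z 0 i); rewrite /= ?mulr0 ?mulr1; ring.
Qed.

(** Leaving the subcube is penalised by more than anything that can be won on
the coordinates inside, so only the selected points of the subcube matter. *)
Lemma weights_adj A x y (w : 'I_n -> R) :
  x \in A -> y \in A -> x != y -> \sum_(i in diff x y) w i = 0 ->
  (forall z, z \in inner A x y -> \sum_(i in diff x z) w i < 0) ->
  skeleton_adj R A x y.
Proof.
move=> xA yA xy w0 wA.
have [M ME] : exists M, M = \sum_(i in diff x y) `|w i| by eexists.
have M0 : 0 <= M by rewrite ME; apply: sumr_ge0.
have [c [b cE]] := weight_dot x (fun i => if i \in diff x y then w i else - (M + 1)).
apply: (exposed_segment_adj (c := c) (b := b)) => //.
- by rewrite cE diffxx big_set0 addr0.
- by rewrite cE (eq_bigr w) ?w0 ?addr0 // => i ->.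
move=> z zA zx zy; rewrite cE -[X in _ < X]addr0 ltrD2l.
have [sz|] := boolP (diff x z \subset diff x y).
  rewrite (eq_bigr w) => [|i /(fintype.subsetP sz) -> //].
  by apply: wA; rewrite !inE zA sz zx.
case/subsetPn => i iz niy; rewrite (bigD1 i) //= (negbTE niy).
have leM : \sum_(j in diff x z | j != i)
    (if j \in diff x y then w j else - (M + 1)) <= M.
  rewrite [leRHS]ME [leLHS]big_mkcond [leRHS]big_mkcond /=; apply: ler_sum => j _.
  have := ler_norm (w j); have := normr_ge0 (w j).
  by case: ifP => _; case: ifP => _; lra.
lra.
Qed.

Lemma sum_pred1 (E : {set 'I_n}) (a : 'I_n) :
  \sum_(i in E) (i == a)%:R = (a \in E)%:R :> R.
Proof.
have [aE|aE] := boolP (a \in E).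
  rewrite (bigD1 a) //= eqxx big1 ?addr0 // => i /andP[_ /negbTE ->] //.
by rewrite big1 // => i iE; case: eqP => // ia; rewrite -ia iE in aE.
Qed.

(** Since [D2] is not the complement of [D1], some [i] belongs to both or to
neither. In the first case, charge -2 to [i] and give +1 to an element
of [D] outside [D1] and +1 to one outside [D2]: each of the two sets misses one of the
bonuses. The second case is symmetric under complementation. *)
Lemma separating_weights (D D1 D2 : {set 'I_n}) :
  D1 \proper D -> D2 \proper D -> D1 != finset.set0 -> D2 != finset.set0 ->
  D2 != D :\: D1 ->
  exists w : 'I_n -> R, [/\ \sum_(i in D) w i = 0,
    \sum_(i in D1) w i < 0 & \sum_(i in D2) w i < 0].
Proof.
move=> /properP[s1 [a1 a1D a1n]] /properP[s2 [a2 a2D a2n]].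
move=> /set0Pn[b1 b1D] /set0Pn[b2 b2D] D2N.
have wE (s : R) (a b i : 'I_n) (E : {set 'I_n}) :
    \sum_(j in E) s * ((j == a)%:R + (j == b)%:R - 2 * (j == i)%:R) =
    s * ((a \in E)%:R + (b \in E)%:R - 2 * (i \in E)%:R).
  by rewrite -mulr_sumr !big_split /= sumrN -mulr_sumr !sum_pred1.
have [i iD e12] : exists2 i, i \in D & (i \in D1) = (i \in D2).
  suff /exists_inP[i iD /eqP ?] : [exists i in D, (i \in D1) == (i \in D2)].
    by exists i.
  rewrite -[X in is_true X]negbK negb_exists_in.
  apply: contra D2N => /forall_inP h; apply/eqP/setP => i; rewrite inE.
  have [iD|iD] := boolP (i \in D); last first.
    by rewrite andbF; apply: contraNF iD; apply/fintype.subsetP.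
  by move: (h _ iD); case: (i \in D1); case: (i \in D2).
have [iD1|iD1] := boolP (i \in D1).
  exists (fun j => 1 * ((j == a1)%:R + (j == a2)%:R - 2 * (j == i)%:R)).
  rewrite !wE iD a1D a2D -e12 iD1 (negbTE a1n) (negbTE a2n) /=.
  by split; [lra|case: (_ \in D1) => /=; lra|case: (_ \in D2) => /=; lra].
exists (fun j => - 1 * ((j == b1)%:R + (j == b2)%:R - 2 * (j == i)%:R)).
rewrite !wE iD -e12 (negbTE iD1) b1D b2D.
rewrite (fintype.subsetP s1 _ b1D) (fintype.subsetP s2 _ b2D) /=.
by split; [lra|case: (_ \in D1) => /=; lra|case: (_ \in D2) => /=; lra].
Qed.

(** Two antipodal points are the only obstruction of size at most two: their
midpoint is the midpoint of [x] and [y]. *)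
Lemma nonadjacent_obstruction A x y :
  x \in A -> y \in A -> x != y -> ~ skeleton_adj R A x y ->
  (2 < #|inner A x y|)%N \/
  exists2 z, z \in inner A x y & antipode x y z \in inner A x y.
Proof.
move=> xA yA xy nadj.
have [|le2] := ltnP 2 #|inner A x y|; [by left|right].
apply: contrapT => nanti; apply: nadj.
have properD z : z \in inner A x y -> diff x z \proper diff x y.
  rewrite !inE finset.properEneq => /and4P[_ -> _ zy].
  by rewrite (inj_eq (diff_inj (x := x))) zy.
have D0 z : z \in inner A x y -> diff x z != finset.set0.
  by rewrite !inE diff_eq0 eq_sym => /and4P[_ _ -> _].
have two z1 z2 : inner A x y = [set z1; z2]%SET -> skeleton_adj R A x y.
  move=> S12.
  have z1S : z1 \in inner A x y by rewrite S12 !inE eqxx.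
  have z2S : z2 \in inner A x y by rewrite S12 !inE eqxx orbT.
  have [|w [w0 w1 w2]] := separating_weights (properD _ z1S) (properD _ z2S)
    (D0 _ z1S) (D0 _ z2S).
    apply/eqP => D2E; apply: nanti; exists z1 => //.
    by rewrite /antipode -D2E flip_diff.
  apply: (weights_adj (w := w)) => // z; rewrite S12 !inE.
  by case/orP => /eqP ->.
have [S0|Sn0] := eqVneq (inner A x y) finset.set0.
  apply: (weights_adj (w := fun=> 0)) => //; first by rewrite big1.
  by move=> z; rewrite S0 inE.
have [z zS] : exists z, z \in inner A x y by apply/set0Pn.
move: le2; rewrite leq_eqVlt ltnS => /orP[/cards2P[z1 [z2 [_ S12]]]|le1].
  exact: two S12.
(* A single inner point plays both roles. *)
have /cards1P[z1 S1] : #|inner A x y| == 1%N by rewrite eqn_leq le1 card_gt0.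
by apply: (two z1 z1); rewrite S1 finset.setUid.
Qed.

End Geometry.

(** * Expectations over the random set *)

Section Probability.
Context {R : realType} {n : nat} (p : R) (hp : 0 <= p <= 1).
Implicit Types (x y z : cube n) (A S T : {set cube n}) (X Y : {set cube n} -> R).

Definition Ex X : R := \sum_A mass p A * X A.

Lemma mass_ge0 A : 0 <= mass p A.
Proof.
case/andP: hp => p0 p1; apply: prodr_ge0 => x _.
by case: ifP => _ //; rewrite subr_ge0.
Qed.

Lemma Ex_le X Y : (forall A, X A <= Y A) -> Ex X <= Ex Y.
Proof. by move=> XY; apply: ler_sum => A _; rewrite ler_wpM2l ?mass_ge0 ?XY. Qed.

(** Independence of the points, in the form of the expansion of a product of
binomials. *)
Lemma Ex_prod (f : cube n -> R) (g : cube n -> R) :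
  Ex (fun A => \prod_x (if x \in A then f x else g x)) =
  \prod_x (p * f x + (1 - p) * g x).
Proof.
rewrite bigA_distr; apply: eq_big => [//|A _]; rewrite /mass -big_split.
by apply: eq_bigr => x _; case: ifP.
Qed.

Lemma prod_bool (P : pred (cube n)) : \prod_x (P x)%:R = [forall x, P x]%:R :> R.
Proof.
have [/forallP h|/forallPn[x nx]] := boolP [forall x, P x].
  by rewrite big1 // => x _; rewrite h.
by rewrite (bigD1 x) //= (negbTE nx) mul0r.
Qed.

Lemma Ex_subset S : Ex (fun A => (S \subset A)%:R) = p ^+ #|S|.
Proof.
transitivity (Ex (fun A => \prod_x (if x \in A then 1 else (x \notin S)%:R))).
  apply: eq_bigr => A _; congr (_ * _).
  rewrite -(eq_bigr _ (fun x _ => fun_if (fun b : bool => b%:R) (x \in A) true (x \notin S))).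
  rewrite prod_bool; congr ((nat_of_bool _)%:R); apply/fintype.subsetP/forallP => h x.
    by case: ifP => // /negP xA; apply/negP => /h.
  by move=> xS; have := h x; rewrite xS; case: ifP.
rewrite Ex_prod -prodr_const [RHS]big_mkcond; apply: eq_bigr => x _.
by case: (x \in S) => /=; ring.
Qed.

Lemma Ex_disjoint T : Ex (fun A => (A \subset ~: T)%:R) = (1 - p) ^+ #|T|.
Proof.
transitivity (Ex (fun A => \prod_x (if x \in A then (x \notin T)%:R else 1))).
  apply: eq_bigr => A _; congr (_ * _).
  rewrite -(eq_bigr _ (fun x _ => fun_if (fun b : bool => b%:R) (x \in A) (x \notin T) true)).
  rewrite prod_bool; congr ((nat_of_bool _)%:R).
  apply/fintype.subsetP/forallP => h x; first by case: ifP => // /h; rewrite inE.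
  by move=> xA; have := h x; rewrite xA inE.
rewrite Ex_prod -prodr_const [RHS]big_mkcond; apply: eq_bigr => x _.
by case: (x \in T) => /=; ring.
Qed.

Lemma Ex_const c : Ex (fun=> c) = c.
Proof.
have := Ex_subset finset.set0; rewrite /Ex cards0 expr0.
under eq_bigr do rewrite finset.sub0set mulr1.
by rewrite -mulr_suml => ->; rewrite mul1r.
Qed.

Lemma Ex_sum (I : Type) (r : seq I) (P : pred I) (F : I -> {set cube n} -> R) :
  Ex (fun A => \sum_(i <- r | P i) F i A) = \sum_(i <- r | P i) Ex (F i).
Proof. by rewrite exchange_big; apply: eq_bigr => A _; rewrite mulr_sumr. Qed.

Lemma ExD X Y : Ex (fun A => X A + Y A) = Ex X + Ex Y.
Proof. by rewrite -big_split; apply: eq_bigr => A _; rewrite mulrDr. Qed.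

Lemma ExZ c X : Ex (fun A => c * X A) = c * Ex X.
Proof. by rewrite [RHS]mulr_sumr; apply: eq_bigr => A _; rewrite mulrCA. Qed.

Lemma PrE (E : set {set cube n}) : Pr p E = Ex (fun A => `[< E A >]%:R).
Proof.
rewrite /Pr big_mkcond; apply: eq_bigr => A _.
by case: ifP => _; rewrite ?mulr1 ?mulr0.
Qed.

Lemma Pr_le1 (E : set {set cube n}) : Pr p E <= 1.
Proof. by rewrite PrE -[leRHS](Ex_const 1); apply: Ex_le => A; case: asbool. Qed.

Lemma Pr_setC (E : set {set cube n}) : Pr p (~` E) = 1 - Pr p E.
Proof.
apply/eqP; rewrite eq_sym subr_eq !PrE -ExD -[X in X == _](Ex_const 1).
apply/eqP; apply: eq_bigr => A _; congr (_ * _).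
have [EA|EA] := pselect (E A).
  by rewrite (asboolT EA) asboolF ?add0r //; apply.
by rewrite (asboolF EA) asboolT ?addr0.
Qed.

Lemma Pr_markov (E : set {set cube n}) X :
  (forall A, 0 <= X A) -> (forall A, E A -> 1 <= X A) -> Pr p E <= Ex X.
Proof.
move=> X0 X1; rewrite PrE; apply: Ex_le => A.
by have [EA|EA] := pselect (E A); [rewrite asboolT ?X1|rewrite asboolF ?X0].
Qed.

Definition present (s : seq (cube n)) A : R := (all (mem A) s)%:R.

(** Repetitions in [s] are allowed, which is what the second moment needs. *)
Lemma Ex_present s : Ex (present s) = p ^+ size (undup s).
Proof.
rewrite -(card_uniqP (undup_uniq s)) -cardsE -Ex_subset.
apply: eq_bigr => A _; congr (_ * (nat_of_bool _)%:R).
apply/allP/fintype.subsetP => h x; first by rewrite inE mem_undup => /h.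
by move=> xs; apply: h; rewrite inE mem_undup.
Qed.

Lemma Ex_present_uniq s : uniq s -> Ex (present s) = p ^+ size s.
Proof. by move=> us; rewrite Ex_present undup_id. Qed.

Lemma present_ge0 s A : 0 <= present s A.
Proof. by rewrite /present ler0n. Qed.

(** The indicators of the two obstructions to the adjacency of [x] and [y]. *)
Definition crowded x y A : R :=
  [&& x \in A, y \in A, x != y & (2 < #|inner A x y|)%N]%:R.

Definition antipodal x y A : R :=
  [&& x \in A, y \in A, x != y &
    [exists z in inner A x y, antipode x y z \in inner A x y]]%:R.

Lemma Ex_crowded2 x y : Ex (crowded x y) <= p ^+ 2.
Proof.
case/andP: hp => p0 p1.
have [->|xy] := eqVneq x y.
  rewrite [X in X <= _](_ : _ = 0) ?exprn_ge0 // -[RHS](Ex_const 0).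
  by apply: eq_bigr => A _; rewrite /crowded eqxx /= !andbF.
rewrite -[2%N]/(size [:: x; y]) -Ex_present_uniq /= ?inE ?xy //.
apply: Ex_le => A; rewrite /crowded /present /= xy ler_nat.
by case: (x \in A); case: (y \in A); case: (2 < _)%N.
Qed.

Lemma sum_subcube_const x y (c : R) :
  \sum_(z in subcube x y) c = c * 2 ^+ #|diff x y|.
Proof. by rewrite sumr_const card_subcube -[LHS]mulr_natr natrX. Qed.

(** Union bound over the three further points, each among the [2 ^ d] points of
the subcube. *)
Lemma Ex_crowded5 x y : Ex (crowded x y) <= p ^+ 5 * (2 ^+ #|diff x y|) ^+ 3.
Proof.
case/andP: hp => p0 p1.
pose F z1 z2 z3 A : R := (uniq [:: x; y; z1; z2; z3])%:R * present [:: x; y; z1; z2; z3] A.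
have F0 z1 z2 z3 A : 0 <= F z1 z2 z3 A by rewrite mulr_ge0 ?ler0n ?present_ge0.
apply: (@le_trans _ _ (Ex (fun A => \sum_(z1 in subcube x y) \sum_(z2 in subcube x y)
  \sum_(z3 in subcube x y) F z1 z2 z3 A))).
  apply: Ex_le => A; rewrite /crowded.
  case: and4P => [[xA yA xy /card_gt2P[z1 [z2 [z3 [[z1S z2S z3S] [z12 z23 z31]]]]]]|_]; last first.
    by do 3 (apply: sumr_ge0 => ? _).
  move: z1S z2S z3S; rewrite !inE => /and4P[z1A z1D z1x z1y].
  move=> /and4P[z2A z2D z2x z2y] /and4P[z3A z3D z3x z3y].
  rewrite (bigD1 z1) ?inE //= (bigD1 z2) ?inE //= (bigD1 z3) ?inE //= -!addrA.
  rewrite {1}/F /present /= xA yA z1A z2A z3A !inE.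
  rewrite !negb_or xy ![x == _]eq_sym ![y == _]eq_sym z1x z2x z3x z1y z2y z3y z12 z23.
  rewrite [z1 == z3]eq_sym z31 mulr1 lerDl.
  by rewrite !addr_ge0 //; do 3 (try apply: sumr_ge0 => ? _).
rewrite Ex_sum.
apply: (@le_trans _ _ (\sum_(z1 in subcube x y) \sum_(z2 in subcube x y)
  \sum_(z3 in subcube x y) p ^+ 5)); last first.
  by rewrite !sum_subcube_const [X in _ <= _ * X]exprS expr2 !mulrA.
apply: ler_sum => z1 _; rewrite Ex_sum; apply: ler_sum => z2 _.
rewrite Ex_sum; apply: ler_sum => z3 _.
rewrite ExZ; have [u|_] := boolP (uniq _); last by rewrite mul0r exprn_ge0.
by rewrite mul1r Ex_present_uniq.
Qed.

(** Choosing one of two antipodal points determines the other, so there are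
only [2 ^ d] choices for the four points. *)
Lemma Ex_antipodal x y : Ex (antipodal x y) <= p ^+ 4 * 2 ^+ #|diff x y|.
Proof.
case/andP: hp => p0 p1.
pose s z := [:: x; y; z; antipode x y z].
pose F z A : R := (uniq (s z))%:R * present (s z) A.
have F0 z A : 0 <= F z A by rewrite mulr_ge0 ?ler0n ?present_ge0.
apply: (@le_trans _ _ (Ex (fun A => \sum_(z in subcube x y) F z A))).
  apply: Ex_le => A; rewrite /antipodal.
  case: and4P => [[xA yA xy /exists_inP[z]]|_]; last by apply: sumr_ge0.
  rewrite !inE => /and4P[zA zD zx zy] /and4P[wA wD wx wy].
  have zw : z != antipode x y z.
    rewrite -(inj_eq (diff_inj (x := x))) diff_flip.
    apply: contra zx => /eqP/setP h; rewrite eq_sym -diff_eq0 -finset.subset0.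
    apply/fintype.subsetP => i iz; have := h i; rewrite finset.in_setD iz.
    by rewrite (fintype.subsetP zD).
  rewrite (bigD1 z) ?inE //= {1}/F /present /= xA yA zA wA !inE !negb_or.
  rewrite xy ![x == _]eq_sym ![y == _]eq_sym zx zy wx wy zw mulr1 lerDl.
  exact: sumr_ge0.
rewrite Ex_sum -sum_subcube_const; apply: ler_sum => z _.
rewrite ExZ; have [u|_] := boolP (uniq _); last by rewrite mul0r exprn_ge0.
by rewrite mul1r Ex_present_uniq.
Qed.

(** Keeping the smaller of the two bounds for crowded pairs is essential: the
union bound is useless for distant pairs, because their subcubes are large, and
the bound [p ^ 2] is useless for pairs at typical distance, because there are
too many of them. *)
Lemma Pr_nonclique :
  Pr p [set A : {set cube n} | ~ is_clique R A] <=
  \sum_(x : cube n) \sum_(y : cube n) (p ^+ 2 * Num.min 1 ((p * 2 ^+ #|diff x y|) ^+ 3)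
                 + p ^+ 4 * 2 ^+ #|diff x y|).
Proof.
case/andP: hp => p0 p1.
apply: (@le_trans _ _ (Ex (fun A => \sum_x \sum_y (crowded x y A + antipodal x y A)))).
  apply: Pr_markov => A.
    by do 2 (apply: sumr_ge0 => ? _); rewrite addr_ge0 // ler0n.
  move=> /= /existsNP[x /existsNP[y]].
  move=> /not_implyP[xA /not_implyP[yA /not_implyP[xy nadj]]].
  rewrite (bigD1 x) //= (bigD1 y) //=.
  rewrite -addrA ler_wpDr //; first rewrite addr_ge0 //.
  - by apply: sumr_ge0 => ? _; rewrite addr_ge0 // ler0n.
  - by do 2 (apply: sumr_ge0 => ? _); rewrite addr_ge0 // ler0n.
  rewrite /crowded /antipodal xA yA xy /=.
  have [->|[z zS wS]] := nonadjacent_obstruction xA yA xy nadj.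
    by rewrite lerDl ler0n.
  have -> : [exists z in inner A x y, antipode x y z \in inner A x y].
    by apply/exists_inP; exists z.
  by rewrite lerDr ler0n.
rewrite Ex_sum; apply: ler_sum => x _; rewrite Ex_sum; apply: ler_sum => y _.
rewrite ExD lerD ?Ex_antipodal //.
rewrite minr_pMr ?exprn_ge0 // mulr1 le_min Ex_crowded2 /=.
by rewrite exprMn mulrA -exprD Ex_crowded5.
Qed.

End Probability.

(** * The threshold equation and the first moment *)

Section Threshold.
Context {R : realType} (delta : R).
Hypotheses (hdelta : 1 / 2 < delta <= 1) (hH : entropy delta = 2 * delta - 1).

Local Notation q := (2 `^ (- delta)).
Local Notation r := (delta / (1 - delta)).

Let ln2_gt0 : 0 < ln 2 :> R.
Proof. by apply: ln_gt0; lra. Qed.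

Let delta_gt0 : 0 < delta.
Proof. by move: hdelta; lra. Qed.

Lemma delta_lt1 : delta < 1.
Proof.
case/andP: hdelta => _; rewrite le_eqVlt => /orP[/eqP d1|//].
by move: hH; rewrite d1 /entropy /log2 ln1 subrr !mul0r mulr0; lra.
Qed.

Lemma entropy_ln :
  - delta * ln delta - (1 - delta) * ln (1 - delta) = (2 * delta - 1) * ln 2.
Proof.
by rewrite -hH /entropy /log2; field; rewrite gt_eqF.
Qed.

Lemma ratio_gt1 : 1 < r.
Proof.
have := delta_lt1; have := hdelta => h1 h2.
by rewrite ltr_pdivlMr; lra.
Qed.

Lemma ln_ratio : ln r = ln delta - ln (1 - delta).
Proof. by rewrite ln_div // posrE subr_gt0 delta_lt1. Qed.

Lemma ratioD1 : 1 + r = (1 - delta)^-1.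
Proof. by field; have := delta_lt1; lra. Qed.

(** Gibbs' inequality against the distribution (8/9, 1/9) bounds the entropy by
[log2 9 - 3 delta]. The value 8/9 is the one for which the ratio [r] equals 8, so this
makes [log2 r] at most 3. *)
Lemma delta_le : delta <= 8 / 9.
Proof.
have d1 := delta_lt1; have d0 := delta_gt0.
have lnle (x : R) : 0 < x -> ln x <= x - 1.
  by move=> x0; have := @le_ln1Dx R (x - 1); rewrite [1 + _]addrC subrK; apply; lra.
have h1 : ln (8 / 9 / delta) <= 8 / 9 / delta - 1 by apply/lnle/divr_gt0; lra.
have h2 : ln (1 / 9 / (1 - delta)) <= 1 / 9 / (1 - delta) - 1 by apply/lnle/divr_gt0; lra.
have {}h1 : delta * ln (8 / 9 / delta) <= 8 / 9 - delta.
  apply: (le_trans (ler_wpM2l (ltW d0) h1)).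
  by rewrite le_eqVlt; apply/orP; left; apply/eqP; field; lra.
have {}h2 : (1 - delta) * ln (1 / 9 / (1 - delta)) <= 1 / 9 - (1 - delta).
  have d10 : 0 <= 1 - delta by lra.
  apply: (le_trans (ler_wpM2l d10 h2)).
  by rewrite le_eqVlt; apply/orP; left; apply/eqP; field; lra.
move: h1 h2; rewrite !ln_div ?posrE ?divr_gt0 ?subr_gt0 //; try lra.
have -> : ln (8 : R) = 3 * ln 2.
  by rewrite mulr_natl -lnXn; [congr ln; rewrite -natrX|lra].
have h9 : 3 * ln (9 : R) <= 10 * ln 2.
  rewrite !mulr_natl -!lnXn; try lra.
  by rewrite ler_ln ?posrE ?exprn_gt0 // -!natrX ler_nat.
rewrite ln1 => h1 h2; have := entropy_ln => hE.
by rewrite -(ler_pM2r ln2_gt0); have := ln2_gt0; lra.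
Qed.

(** From [- ln t >= 1 - t], [1 - delta <= 1 / 2] and [ln 2 <= 1], the entropy is at
least [1 - delta ^ 2]; hence [delta ^ 2 + 2 delta >= 2]. *)
Lemma delta_ge : 11 / 16 <= delta.
Proof.
have d1 := delta_lt1; have d0 := delta_gt0; have := hdelta => /andP[d2 _].
have l21 : ln (2 : R) <= 1 by have := @le_ln1Dx R 1; apply; lra.
have h1 : ln delta <= delta - 1.
  by have := @le_ln1Dx R (delta - 1); rewrite [1 + _]addrC subrK; apply; lra.
have h2 : ln (1 - delta) <= - ln 2.
  rewrite -lnV ?posrE //; rewrite ler_ln ?posrE ?invr_gt0 ?subr_gt0 //.
  by lra.
have {}h1 : delta * (1 - delta) <= - delta * ln delta.
  by have := ler_wpM2l (ltW d0) h1; lra.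
have {}h2 : (1 - delta) * ln 2 <= - (1 - delta) * ln (1 - delta).
  have d10 : 0 <= 1 - delta by lra.
  by have := ler_wpM2l d10 h2; lra.
have := entropy_ln => hE.
have h3 : delta * (1 - delta) * ln 2 <= delta * (1 - delta).
  by rewrite -[leRHS]mulr1 ler_wpM2l // mulr_ge0; lra.
rewrite leNgt; apply/negP => d3.
have : (2 - 2 * delta - delta ^+ 2) * ln 2 <= 0 by lra.
have : 0 < 2 - 2 * delta - delta ^+ 2.
  nra.
by move=> h4; rewrite pmulr_rle0 // leNgt ln2_gt0.
Qed.

Lemma q_gt0 : 0 < q.
Proof. by apply: powR_gt0. Qed.

Lemma ln_q : ln q = - delta * ln 2.
Proof. by rewrite ln_powR. Qed.

(** The logarithm of the left-hand side is [(1 - 2 delta + H(delta)) ln 2]. *)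
Lemma threshold_identity : 2 * (1 + r) * q ^+ 2 * r `^ (- delta) = 1.
Proof.
have d1 := delta_lt1; have r1 := ratio_gt1.
have r0 : 0 < r by lra.
apply: ln_inj; rewrite ?posrE ?mulr_gt0 ?exprn_gt0 ?q_gt0 ?powR_gt0 //; try lra.
rewrite ratioD1 ln1 !lnM ?posrE ?mulr_gt0 ?exprn_gt0 ?q_gt0 ?powR_gt0 ?invr_gt0 ?subr_gt0 //.
rewrite !ln_powR lnV ?posrE ?subr_gt0 // ln_ratio.
by have := entropy_ln; lra.
Qed.

(** The number of quadruples made of a pair and an antipodal pair of its subcube is
at most [6 ^ n]; the lower bound on [delta] makes their expected number decay. *)
Lemma q4_lt : 6 * q ^+ 4 < 1.
Proof.
rewrite -ltr_ln ?posrE ?mulr_gt0 ?exprn_gt0 ?q_gt0 // ln1 lnM ?posrE ?exprn_gt0 ?q_gt0 //.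
rewrite lnXn ?q_gt0 // ln_q.
have h : 4 * ln (6 : R) < 11 * ln 2.
  rewrite !mulr_natl -!lnXn //.
  by rewrite ltr_ln ?posrE ?exprn_gt0 // -!natrX ltr_nat.
by have := ler_wpM2r (ltW ln2_gt0) delta_ge; rewrite -[X in _ + X < _]mulr_natl; lra.
Qed.

Let s := ln r / ln 2.

Lemma powR_s : 2 `^ s = r.
Proof.
have r0 : 0 < r by have := ratio_gt1; lra.
by apply: ln_inj; rewrite ?posrE ?powR_gt0 // ln_powR divfK // gt_eqF.
Qed.

Lemma s_ge0 : 0 <= s.
Proof. by rewrite divr_ge0 ?(ltW ln2_gt0) // ln_ge0 // ltW // ratio_gt1. Qed.

Lemma s_le3 : s <= 3.
Proof.
rewrite ler_pdivrMr // mulr_natl -lnXn // ler_ln ?posrE ?exprn_gt0 //; last first.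
  by have := ratio_gt1; lra.
have := delta_lt1; have := delta_le => h1 h2.
by rewrite ler_pdivrMr; lra.
Qed.

Lemma q_powR_s : q `^ s = r `^ (- delta).
Proof. by rewrite -powRrM mulrC powRrM powR_s. Qed.

(** The exponents 0 and 3 are interpolated by [s]. *)
Lemma min1_cube_le (u : R) : 0 < u -> Num.min 1 (u ^+ 3) <= u `^ s.
Proof.
move=> u0; have [u1|u1] := leP 1 u.
  rewrite ge_min; apply/orP; left.
  apply: (@le_trans _ _ (1 `^ s)); first by rewrite powR1.
  by apply: ge0_ler_powR; rewrite ?nnegrE ?s_ge0 ?(ltW u0).
rewrite ge_min; apply/orP; right.
rewrite -powR_mulrn ?(ltW u0) //.
by apply: ger_powR; rewrite ?u0 ?s_le3 ?(ltW u1).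
Qed.

(** At [p = (a q) ^ n] the interpolated bound for a pair at distance [d] is
[((a q) ^ 2 r ^ (- delta)) ^ n * r ^ d], whose sum over all pairs is computed by
the threshold identity. *)
Lemma first_moment_le n (a p : R) : 0 <= a <= 1 -> 0 <= p <= (a * q) ^+ n ->
  \sum_(x : cube n) \sum_(y : cube n)
    (p ^+ 2 * Num.min 1 ((p * 2 ^+ #|diff x y|) ^+ 3) + p ^+ 4 * 2 ^+ #|diff x y|)
  <= (a ^+ 2) ^+ n + (6 * q ^+ 4) ^+ n.
Proof.
move=> /andP[a0 a1] /andP[p0 pa].
have qn0 : 0 < q ^+ n by rewrite exprn_gt0 // q_gt0.
have pq : p <= q ^+ n.
  apply: (le_trans pa); rewrite exprMn -[leRHS]mul1r.
  by rewrite ler_wpM2r ?(ltW qn0) // exprn_ile1.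
have r0 : 0 < r by have := ratio_gt1; lra.
have term (d : nat) : p ^+ 2 * Num.min 1 ((p * 2 ^+ d) ^+ 3) + p ^+ 4 * 2 ^+ d <=
    (a * q) ^+ n ^+ 2 * (r `^ (- delta)) ^+ n * r ^+ d + q ^+ n ^+ 4 * 2 ^+ d.
  have d0 : 0 < 2 ^+ d :> R by rewrite exprn_gt0.
  apply: lerD; last by rewrite ler_wpM2r ?(ltW d0) // lerXn2r // nnegrE // ltW.
  rewrite -mulrA; apply: ler_pM.
  - by rewrite exprn_ge0.
  - by rewrite le_min ler01 exprn_ge0 // mulr_ge0 // ltW.
  - by rewrite lerXn2r // nnegrE // exprn_ge0 // mulr_ge0 // ltW // q_gt0.
  have -> : (r `^ (- delta)) ^+ n * r ^+ d = (q ^+ n * 2 ^+ d) `^ s.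
    rewrite [RHS]powRM ?(ltW qn0) ?(ltW d0) // -q_powR_s -[X in _ = _ `^ _ * (X `^ _)]powR_mulrn //.
    rewrite -[X in _ = X `^ _ * _]powR_mulrn ?(ltW q_gt0) //.
    rewrite -!(powRAC _ s) !powR_mulrn ?powR_ge0 //.
    by rewrite powR_s.
  apply: le_trans (min1_cube_le (mulr_gt0 qn0 d0)).
  rewrite le_min !ge_min lexx /=; apply/orP; right.
  by rewrite lerXn2r ?nnegrE ?mulr_ge0 ?(ltW qn0) ?(ltW d0) // ler_wpM2r // ltW.
apply: (@le_trans _ _ (\sum_(x : cube n) \sum_(y : cube n)
   ((a * q) ^+ n ^+ 2 * (r `^ (- delta)) ^+ n * r ^+ #|diff x y|
     + q ^+ n ^+ 4 * 2 ^+ #|diff x y|))).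
  by apply: ler_sum => x _; apply: ler_sum => y _; exact: term.
under eq_bigr do rewrite big_split -!mulr_sumr !sum_dist_pow.
rewrite /= sumr_const card_mx card_bool mul1n -[leLHS]mulr_natl natrX.
rewrite mulrDr le_eqVlt; apply/orP; left; apply/eqP; congr (_ + _).
  rewrite (exprAC _ n 2) -!exprMn; congr (_ ^+ n).
  have := threshold_identity; set A := 1 + r; set B := r `^ _ => h.
  transitivity (a ^+ 2 * (2 * A * q ^+ 2 * B)); first by ring.
  by rewrite h mulr1.
by rewrite (exprAC _ n 4) -!exprMn; congr (_ ^+ n); ring.
Qed.

End Threshold.

(** * Halfspaces cutting the cube *)

Lemma diffC {n} (x y : cube n) : diff x y = diff y x.
Proof. by apply/setP => i; rewrite !inE eq_sym. Qed.

Section Halfspaces.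
Context {R : realType} {n : nat}.
Implicit Types (x y z : cube n) (A f g : {set cube n}).

Local Notation pt := (@cube_pt R n).

Definition halfspace_trace (c : 'rV[R]_n) (b : R) : {set cube n} :=
  [set z | b <= dot c (pt z)].

Definition halfspace_traces : {set {set cube n}} :=
  [set f | `[< exists c b, f = halfspace_trace c b >]].

(** The Chow parameters: the size of the set and its sum, coordinate by
coordinate. *)
Definition chow f : {ffun option 'I_n -> 'I_(2 ^ n).+1} :=
  [ffun o => if o is Some i then inord #|f :&: [set z : cube n | z 0 i]%SET| else inord #|f|].

Lemma card_cube : #|cube n| = (2 ^ n)%N.
Proof. by rewrite card_mx card_bool mul1n. Qed.

Lemma sum_dot c f :
  \sum_(z in f) dot c (pt z) = \sum_(i < n) c 0 i * #|f :&: [set z : cube n | z 0 i]%SET|%:R.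
Proof.
rewrite exchange_big /=; apply: eq_bigr => i _; rewrite -mulr_sumr; congr (_ * _).
rewrite -sum1_card natr_sum big_mkcond [RHS]big_mkcond; apply: eq_bigr => z _.
by rewrite !inE mxE; case: (z \in f); case: (z 0 i).
Qed.

(** Equal parameters give equal sums of the functional defining [f]; but
replacing points of [f] by as many points outside it decreases that sum. *)
Lemma chow_inj : {in halfspace_traces &, injective chow}.
Proof.
move=> f g; rewrite !inE => -[c [b fE]] _ /ffunP cfg.
have card_lt (h : {set cube n}) : (#|h| < (2 ^ n).+1)%N by rewrite ltnS -card_cube max_card.
have efg : #|f| = #|g|.
  by have /(congr1 (@nat_of_ord _)) := cfg None; rewrite !ffunE !inordK.
have eifg i : #|f :&: [set z : cube n | z 0 i]%SET| = #|g :&: [set z : cube n | z 0 i]%SET|.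
  by have /(congr1 (@nat_of_ord _)) := cfg (Some i); rewrite !ffunE !inordK.
pose t z := (dot c (pt z) - b) * ((z \in f)%:R - (z \in g)%:R).
have t0 z : 0 <= t z.
  by rewrite /t fE inE; have [zb|zb] := leP b (dot c (pt z)); case: (z \in g) => /=; lra.
(* [t z] is the contribution of [z] to the difference of the two sums. *)
have st : \sum_z t z = 0.
  have sE (h : {set cube n}) :
      \sum_z (dot c (pt z) - b) * (z \in h)%:R = \sum_(z in h) dot c (pt z) - b * #|h|%:R.
    rewrite -sum1_card natr_sum mulr_sumr -sumrB [RHS]big_mkcond /=.
    by apply: eq_bigr => z _; case: (z \in h); rewrite ?mulr1 ?mulr0.
  under eq_bigr do rewrite /t mulrBr.
  rewrite sumrB !sE !sum_dot efg.
  by rewrite (eq_bigr (fun i => c 0 i * #|g :&: [set z : cube n | z 0 i]%SET|%:R)) ?subrr // => i _; rewrite eifg.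
apply/esym/eqP; rewrite eqEcard efg leqnn andbT; apply/fintype.subsetP => z zg.
move/eqP: st; rewrite psumr_eq0 // => /allP /(_ z (mem_index_enum _)) /=.
rewrite /t zg; have [//|] := boolP (z \in f); rewrite fE inE -ltNge => zb.
by rewrite sub0r mulrN1 oppr_eq0 subr_eq0 lt_eqF.
Qed.

Lemma card_halfspace_traces : (#|halfspace_traces| <= (2 ^ n).+1 ^ n.+1)%N.
Proof.
rewrite -(card_in_imset chow_inj); apply: (leq_trans (max_card _)).
by rewrite card_ffun card_option !card_ord.
Qed.

Lemma cube_pt_antipode x y z :
  z \in subcube x y -> pt (antipode x y z) = pt x + pt y - pt z.
Proof.
rewrite inE => /fintype.subsetP zD; apply/rowP => i; rewrite !mxE !inE.
have := zD i; rewrite !inE.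
by case: (x 0 i); case: (y 0 i); case: (z 0 i) => /= h; first [by have := h isT | ring].
Qed.

Lemma antipode_subcube x y z : antipode x y z \in subcube x y.
Proof. by rewrite inE diff_flip finset.subsetDl. Qed.

Lemma antipodeK x y : {in subcube x y, involutive (antipode x y)}.
Proof.
move=> z; rewrite inE => zD; rewrite /antipode diff_flip.
by rewrite finset.setDDr finset.setDv finset.set0U (finset.setIidPr zD) flip_diff.
Qed.

(** The hyperplane contains the centre of the subcube, so of two antipodal points
at least one is on its upper side. The 4 makes up for [x] and [y]
themselves. *)
Lemma adj_halfspace A x y : skeleton_adj R A x y ->
  exists2 f, f \in halfspace_traces &
    (2 ^ #|diff x y| <= 2 * #|inner f x y| + 4)%N && (A \subset ~: inner f x y).
Proof.
move=> adj; have [c [b [cx cy cA]]] := adj_exposed_segment adj.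
exists (halfspace_trace c b); first by rewrite !inE; exists c, b.
set f := halfspace_trace c b; apply/andP; split; last first.
  apply/fintype.subsetP => z zA; rewrite !inE; apply/negP => /and4P[zb _ zx zy].
  by have := cA _ zA zx zy; rewrite ltNge zb.
have anti z : z \in subcube x y -> dot c (pt (antipode x y z)) = 2 * b - dot c (pt z).
  move=> zD; rewrite (cube_pt_antipode zD).
  transitivity (dot c (pt x) + dot c (pt y) - dot c (pt z)); last by rewrite cx cy; ring.
  by rewrite /dot -big_split -sumrB /=; apply: eq_bigr => i _; rewrite !mxE; ring.
have le1 : (#|subcube x y :\: f| <= #|subcube x y :&: f|)%N.
  have inj : {in subcube x y :\: f &, injective (antipode x y)}.
    apply: (can_in_inj (g := antipode x y)) => z; rewrite finset.in_setD => /andP[_].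
    exact: antipodeK.
  rewrite -(card_in_imset inj).
  apply: subset_leq_card; apply/fintype.subsetP => _ /imsetP[z zDf ->].
  move: zDf; rewrite finset.in_setD => /andP[zf zD].
  rewrite finset.in_setI antipode_subcube inE anti //.
  by move: zf; rewrite inE -ltNge => zb; lra.
have le2 : (#|subcube x y :&: f| <= #|inner f x y| + 2)%N.
  apply: (@leq_trans #|inner f x y :|: [set x; y]%SET|); last first.
    by apply: (leq_trans (leq_card_setU _ _)); rewrite leq_add2l cards2; case: eqP.
  apply: subset_leq_card; apply/fintype.subsetP => z; rewrite !inE => /andP[-> ->].
  by case: (z == x); case: (z == y).
rewrite -card_subcube -(cardsID f (subcube x y)).
by move: le1 le2; lia.
Qed.

End Halfspaces.

(** * Pairs at a given distance *)

Section SecondMoment.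
Context {R : realType} {n : nat} (p : R) (hp : 0 <= p <= 1) (d : nat).
Hypothesis d_gt0 : (0 < d)%N.
Implicit Types (x y u v : cube n) (A : {set cube n}).

Let a x y : R := (#|diff x y| == d)%:R.
Let c : R := 'C(n, d)%:R.
Let N : R := 2 ^+ n * c.

Let sum_a x : \sum_y a x y = c.
Proof.
rewrite /c -(card_sphere x) -sum1dep_card natr_sum [RHS]big_mkcond.
by apply: eq_bigr => y _; rewrite /a; case: eqP.
Qed.

Let sum_a' y : \sum_x a x y = c.
Proof. by rewrite -(sum_a y); apply: eq_bigr => x _; rewrite /a diffC. Qed.

Let sum_aa : \sum_x \sum_y a x y = N.
Proof.
by under eq_bigr do rewrite sum_a; rewrite sumr_const card_cube -[LHS]mulr_natl natrX.
Qed.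

Let a_ge0 x y : 0 <= a x y. Proof. exact: ler0n. Qed.

Let a_neq x y : a x y != 0 -> x != y.
Proof.
apply: contraNneq => ->; rewrite /a diffxx cards0.
by rewrite (ltn_eqF d_gt0).
Qed.

Definition far_pairs A : R := \sum_x \sum_y a x y * present [:: x; y] A.

Lemma Ex_far_pairs : Ex p far_pairs = N * p ^+ 2.
Proof.
rewrite Ex_sum -sum_aa mulr_suml; apply: eq_bigr => x _.
rewrite Ex_sum mulr_suml; apply: eq_bigr => y _; rewrite ExZ.
have [->|/a_neq xy] := eqVneq (a x y) 0; first by rewrite !mul0r.
by rewrite Ex_present_uniq //= inE xy.
Qed.

(** Two pairs share no point, one point, or both. *)
Let present_pair_le x y u v : x != y -> u != v ->
  Ex p (present [:: x; y; u; v]) <=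
  p ^+ 4 + p ^+ 3 * ((x == u)%:R + (x == v)%:R + (y == u)%:R + (y == v)%:R)
  + p ^+ 2 * ((x == u)%:R * (y == v)%:R + (x == v)%:R * (y == u)%:R).
Proof.
case/andP: hp => p0 p1 xy uv.
have [q2 q3 q4] : [/\ 0 <= p ^+ 2, 0 <= p ^+ 3 & 0 <= p ^+ 4] by rewrite !exprn_ge0.
rewrite Ex_present /= !inE (negbTE xy) (negbTE uv).
have [xu|xu] := eqVneq x u; have [xv|xv] := eqVneq x v;
  have [yu|yu] := eqVneq y u; have [yv|yv] := eqVneq y v => //=;
  try (by move: xy; rewrite ?xu ?xv ?yu ?yv eqxx);
  try (by move: uv; rewrite -?xu -?xv -?yu -?yv eqxx); lra.
Qed.

Lemma Ex_far_pairs2 :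
  Ex p (fun A => far_pairs A ^+ 2) <= N * (N * p ^+ 4 + 4 * c * p ^+ 3 + 2 * p ^+ 2).
Proof.
case/andP: hp => p0 p1.
have delta1 (f : cube n -> R) x : \sum_u (x == u)%:R * f u = f x.
  rewrite (bigD1 x) //= eqxx mul1r big1 ?addr0 // => u /negbTE.
  by rewrite eq_sym => ->; rewrite mul0r.
have -> : Ex p (fun A => far_pairs A ^+ 2) =
    \sum_x \sum_y a x y * \sum_u \sum_v a u v * Ex p (present [:: x; y; u; v]).
  transitivity (Ex p (fun A => \sum_x \sum_y \sum_u \sum_v
      a x y * (a u v * present [:: x; y; u; v] A))).
    apply: eq_bigr => A _; congr (_ * _); rewrite expr2 [LHS]mulr_suml.
    apply: eq_bigr => x _; rewrite mulr_suml; apply: eq_bigr => y _.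
    rewrite mulr_sumr; apply: eq_bigr => u _; rewrite mulr_sumr; apply: eq_bigr => v _.
    have -> : present [:: x; y; u; v] A = present [:: x; y] A * present [:: u; v] A :> R.
      by rewrite /present /= -natrM mulnb !andbA !andbT.
    by ring.
  rewrite Ex_sum; apply: eq_bigr => x _; rewrite Ex_sum; apply: eq_bigr => y _.
  rewrite Ex_sum mulr_sumr; apply: eq_bigr => u _.
  rewrite Ex_sum mulr_sumr; apply: eq_bigr => v _.
  by rewrite !ExZ.
rewrite -[X in _ <= X * _]sum_aa mulr_suml; apply: ler_sum => x _.
rewrite mulr_suml; apply: ler_sum => y _.
have [->|axy] := eqVneq (a x y) 0; first by rewrite !mul0r.
rewrite ler_wpM2l //.
apply: (@le_trans _ _ (\sum_u \sum_v (a u v * p ^+ 4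
   + p ^+ 3 * ((x == u)%:R * a u v + (x == v)%:R * a u v
              + (y == u)%:R * a u v + (y == v)%:R * a u v)
   + p ^+ 2 * ((x == u)%:R * ((y == v)%:R * a u v)
              + (y == u)%:R * ((x == v)%:R * a u v))))).
  apply: ler_sum => u _; apply: ler_sum => v _.
  have [->|auv] := eqVneq (a u v) 0; first by rewrite !(mulr0, mul0r, addr0).
  apply: (le_trans (ler_wpM2l (a_ge0 u v) (present_pair_le (a_neq axy) (a_neq auv)))).
  by rewrite le_eqVlt; apply/orP; left; apply/eqP; ring.
have e1 z : \sum_u \sum_v (z == u)%:R * a u v = c.
  by under eq_bigr do rewrite -mulr_sumr sum_a; rewrite (delta1 (fun=> c)).
have e2 z : \sum_u \sum_v (z == v)%:R * a u v = c.
  by under eq_bigr do rewrite delta1; rewrite sum_a'.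
have e3 z w : \sum_u \sum_v (z == u)%:R * ((w == v)%:R * a u v) = a z w.
  by under eq_bigr do rewrite -mulr_sumr delta1; rewrite delta1.
under eq_bigr do rewrite !big_split -mulr_suml -!mulr_sumr !big_split.
rewrite !big_split -mulr_suml -!mulr_sumr !big_split /= sum_aa !e1 !e2 !e3.
have a1 z w : a z w <= 1 by rewrite /a; case: eqP.
have q2 : 0 <= p ^+ 2 by rewrite exprn_ge0.
have := ler_wpM2l q2 (a1 x y); have := ler_wpM2l q2 (a1 y x); lra.
Qed.

(** Chebyshev's inequality for the number of ordered pairs at distance [d]. *)
Lemma Pr_no_far_pair : 0 < p -> (d <= n)%N ->
  Pr p [set A : {set cube n} | forall x y, x \in A -> y \in A -> #|diff x y| != d]
  <= 4 / (2 ^+ n * p) + 2 / (N * p ^+ 2).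
Proof.
move=> p0 dn.
have c0 : 0 < c by rewrite ltr0n bin_gt0.
have N0 : 0 < N by rewrite mulr_gt0 // exprn_gt0.
set m := N * p ^+ 2; have m0 : 0 < m by rewrite mulr_gt0 // exprn_gt0.
apply: (@le_trans _ _ (Ex p (fun A => m ^- 2 * (far_pairs A - m) ^+ 2))).
  apply: (Pr_markov hp) => A /=.
    by rewrite mulr_ge0 ?sqr_ge0 // invr_ge0 exprn_ge0 // ltW.
  move=> Afar; rewrite /far_pairs big1 => [|x _].
    by rewrite sub0r sqrrN mulVf // gt_eqF // exprn_gt0.
  apply: big1 => y _; rewrite /a /present /=.
  have [dxy|] := eqVneq; last by rewrite mul0r.
  have := Afar x y; rewrite dxy eqxx.
  case: (x \in A); case: (y \in A) => //=; rewrite ?mulr0 // => /(_ isT isT) //.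
have -> : Ex p (fun A => m ^- 2 * (far_pairs A - m) ^+ 2) =
    m ^- 2 * (Ex p (fun A => far_pairs A ^+ 2) - m ^+ 2).
  rewrite ExZ; congr (_ * _).
  transitivity (Ex p (fun A => far_pairs A ^+ 2 + (- 2 * m * far_pairs A + m ^+ 2))).
    by apply: eq_bigr => A _; congr (_ * _); ring.
  by rewrite !ExD ExZ Ex_far_pairs Ex_const -/m; ring.
have m20 : 0 <= m ^- 2 by rewrite invr_ge0 exprn_ge0 // ltW.
apply: (le_trans (ler_wpM2l m20 (lerB Ex_far_pairs2 (lexx _)))).
rewrite le_eqVlt; apply/orP; left; apply/eqP; rewrite /m /N; field.
by rewrite !gt_eqF ?exprn_gt0.
Qed.

(** Union bound over the two endpoints and over the possible halfspaces. *)
Lemma Pr_far_adj (M : R) :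
  (forall k : nat, (2 ^ d <= 2 * k + 4)%N -> (1 - p) ^+ k <= M) -> 0 <= M ->
  Pr p [set A : {set cube n} | exists x y, #|diff x y| = d /\ skeleton_adj R A x y]
  <= 2 ^+ n * 2 ^+ n * (2 ^+ n + 1) ^+ n.+1 * M.
Proof.
move=> hM M0.
pose X (A : {set cube n}) : R := \sum_(x : cube n) \sum_(y : cube n)
  \sum_(f in @halfspace_traces R n | (2 ^ d <= 2 * #|inner f x y| + 4)%N)
    (A \subset ~: inner f x y)%:R.
apply: (@le_trans _ _ (Ex p X)).
  apply: (Pr_markov hp) => A; first by do 3 (apply: sumr_ge0 => ? _).
  move=> [x [y [dxy /adj_halfspace[f fH /andP[cf Af]]]]].
  rewrite /X (bigD1 x) //= (bigD1 y) //= (bigD1 f) /=; last by rewrite fH -dxy.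
  rewrite Af -!addrA lerDl.
  by rewrite !addr_ge0 //; do 3 (try apply: sumr_ge0 => ? _).
rewrite /X Ex_sum.
apply: (@le_trans _ _ (\sum_(x : cube n) \sum_(y : cube n)
  \sum_(f in @halfspace_traces R n) M)).
  apply: ler_sum => x _; rewrite Ex_sum; apply: ler_sum => y _.
  rewrite Ex_sum [leLHS]big_mkcondr; apply: ler_sum => f _.
  by case: ifP => // cf; rewrite Ex_disjoint hM.
rewrite !sumr_const !card_cube -!mulrnA -[leLHS]mulr_natl.
rewrite ler_wpM2r // [leLHS]natrM mulrC natrM !natrX ler_wpM2l ?mulr_ge0 ?exprn_ge0 //.
have := @card_halfspace_traces R n; rewrite -(ler_nat R) natrX.
by rewrite -addn1 natrD natrX.
Qed.

End SecondMoment.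

(** * Above the threshold *)

Section Supercritical.
Context {R : realType} (delta : R).
Hypotheses (hdelta : 1 / 2 < delta <= 1) (hH : entropy delta = 2 * delta - 1).

Local Notation q := (2 `^ (- delta)).
Local Notation r := (delta / (1 - delta)).

(** Take for [d] the index of a largest term of the expansion of [(1 + r) ^ n]:
comparison with the two neighbouring terms locates it, and a largest term is at
least the average. *)
Lemma binomial_peak n : exists d : nat,
  [/\ (d <= n)%N, n.+1%:R * delta - 1 <= d%:R, d%:R <= n.+1%:R * delta
   & (1 + r) ^+ n <= n.+1%:R * ('C(n, d)%:R * r ^+ d)].
Proof.
have d1 := delta_lt1 hdelta hH.
have d0 : 0 < delta by move: hdelta; lra.
have r0 : 0 < r by rewrite divr_gt0 // subr_gt0.
pose T (d : nat) : R := 'C(n, d)%:R * r ^+ d.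
have [d _ dmax] := @arg_maxP _ _ 'I_n.+1 ord0 predT (fun d => T d) isT.
have dn : (d <= n)%N by rewrite -ltnS ltn_ord.
have {}dmax (e : nat) : (e <= n)%N -> T e <= T d.
  by rewrite -ltnS => en; exact: (dmax (Ordinal en)).
have binS (e : nat) : (e < n)%N ->
    e.+1%:R * 'C(n, e.+1)%:R = (n%:R - e%:R) * 'C(n, e)%:R :> R.
  by move=> en; rewrite -natrM mul_bin_left natrM natrB // ltnW.
have TS (e : nat) : T e.+1 * (1 - delta) = 'C(n, e.+1)%:R * delta * r ^+ e.
  by rewrite /T exprS; field; lra.
have re (e : nat) : 0 < r ^+ e by rewrite exprn_gt0.
have C0 (e : nat) : (e <= n)%N -> 0 < 'C(n, e)%:R :> R by rewrite ltr0n bin_gt0.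
have d10 : 0 <= 1 - delta by lra.
move: (nat_of_ord d) dn dmax => {}d dn dmax.
exists d; split => //.
- move: dn; rewrite leq_eqVlt => /orP[/eqP ->|dn].
    by rewrite -[n.+1%:R]natr1; have : 0 <= n%:R :> R by []; nra.
  have h : 'C(n, d.+1)%:R * delta <= 'C(n, d)%:R * (1 - delta).
    rewrite -(ler_pM2r (re d)) -TS [leRHS]mulrAC.
    exact: ler_wpM2r d10 _ _ (dmax _ dn).
  have : 'C(n, d)%:R * ((n%:R - d%:R) * delta) <= 'C(n, d)%:R * (d.+1%:R * (1 - delta)).
    have -> : 'C(n, d)%:R * ((n%:R - d%:R) * delta) = d.+1%:R * ('C(n, d.+1)%:R * delta).
      by rewrite [RHS]mulrA binS //; ring.
    by rewrite [leRHS]mulrCA ler_wpM2l.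
  by rewrite ler_pM2l ?C0 ?(ltnW dn) // -[n.+1%:R]natr1 -[d.+1%:R]natr1; lra.
- move: dn dmax; case: d => [|e] en dmax.
    by rewrite mulr_ge0 // ltW.
  have h : 'C(n, e)%:R * (1 - delta) <= 'C(n, e.+1)%:R * delta.
    rewrite -(ler_pM2r (re e)) -TS [leLHS]mulrAC.
    exact: ler_wpM2r d10 _ _ (dmax _ (ltnW en)).
  have : 'C(n, e)%:R * (e.+1%:R * (1 - delta)) <= 'C(n, e)%:R * ((n%:R - e%:R) * delta).
    have -> : 'C(n, e)%:R * ((n%:R - e%:R) * delta) = e.+1%:R * ('C(n, e.+1)%:R * delta).
      by rewrite [RHS]mulrA binS //; ring.
    by rewrite mulrCA ler_wpM2l.
  by rewrite ler_pM2l ?C0 ?(ltnW en) // -[n.+1%:R]natr1 -[e.+1%:R]natr1; lra.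
- have -> : (1 + r) ^+ n = \sum_(e < n.+1) T e.
    by rewrite exprDn; apply: eq_bigr => e _; rewrite expr1n mul1r /T mulr_natl.
  rewrite mulr_natl -[n.+1 in leRHS]card_ord -sumr_const.
  by apply: ler_sum => e _; apply: dmax; rewrite -ltnS ltn_ord.
Qed.

(** Any exponential beats any polynomial; the term of degree 4 of the exponential
series suffices. *)
Lemma growth (e : R) : 0 < e ->
  exists N, forall n, (N <= n)%N -> 8 * (n%:R + 3) ^+ 3 <= (1 + e) ^+ n.
Proof.
move=> e0; set L := ln (1 + e).
have L0 : 0 < L by apply: ln_gt0; lra.
have K0 : 0 <= 24 * 64 / L ^+ 4.
  by apply: divr_ge0; [apply: mulr_ge0; exact: ler0n|apply: exprn_ge0; exact: ltW].
exists (maxn 3 (Num.bound (24 * 64 / L ^+ 4))) => n; rewrite geq_max => /andP[n3 nK].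
have eE : 1 + e = expR L by rewrite lnK // posrE; lra.
rewrite eE -expRM_natl.
apply: le_trans (expR_ge1Dxn 3 (mulr_ge0 (ler0n R n) (ltW L0))).
have {}n3 : 3 <= n%:R :> R by rewrite (ler_nat R 3).
have {nK} nK : 24 * 64 <= n%:R * L ^+ 4.
  rewrite -ler_pdivrMr ?exprn_gt0 //; apply: ltW; apply: (lt_le_trans (archi_boundP K0)).
  by rewrite ler_nat.
set x : R := n%:R in n3 nK *.
have h1 : (x + 3) ^+ 3 <= (2 * x) ^+ 3 by rewrite lerXn2r ?nnegrE; lra.
have h2 : 24 * 64 * x ^+ 3 <= (x * L) ^+ 4.
  have -> : (x * L) ^+ 4 = (x * L ^+ 4) * x ^+ 3 by ring.
  by rewrite ler_wpM2r // exprn_ge0 //; lra.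
have -> : 4`!%:R = 24 :> R by [].
move: h1; rewrite exprMn; lra.
Qed.

Lemma q_ge_half : 2^-1 <= q.
Proof.
rewrite -[2^-1]powR_inv1 //; apply: ler_powR; first lra.
by move: hdelta; lra.
Qed.

Lemma ratio_powR_ge : 8^-1 <= r `^ (- delta).
Proof.
have r1 := ratio_gt1 hdelta hH.
have r8 : r <= 8.
  have := delta_lt1 hdelta hH; have := delta_le hdelta hH => h1 h2.
  by rewrite ler_pdivrMr; lra.
have r0 : 0 < r by lra.
apply: (@le_trans _ _ (r `^ (-1))).
  by rewrite powR_inv1 ?(ltW r0) // lef_pV2 ?posrE.
by apply: (ler_powR (ltW r1)); move: hdelta; lra.
Qed.

Section LargeDimension.
(** [G] stands for [(1 + eps) ^ n]. *)
Variables (G p : R) (n : nat).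
Hypotheses (n0 : (0 < n)%N) (p1 : p <= 1) (pG : G * q ^+ n <= p).
Hypothesis large : 8 * (n%:R + 3) ^+ 3 <= G.

Local Notation x := (n%:R : R).

Let x0 : 0 <= x. Proof. exact: ler0n. Qed.
Let q0 : 0 < q. Proof. exact: q_gt0. Qed.

Let cubeE : (x + 3) ^+ 3 = x ^+ 3 + 9 * x ^+ 2 + 27 * x + 27. Proof. by ring. Qed.
Let x2 : 0 <= x ^+ 2. Proof. exact: exprn_ge0. Qed.
Let x3 : 0 <= x ^+ 3. Proof. exact: exprn_ge0. Qed.

Let G_gt0 : 0 < G.
Proof.
have h : 0 < 8 * (x + 3) ^+ 3 by rewrite cubeE; move: x0 x2 x3; lra.
exact: lt_le_trans h large.
Qed.

Let p_gt0 : 0 < p.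
Proof. by apply: lt_le_trans pG; rewrite mulr_gt0 ?G_gt0 ?exprn_gt0. Qed.

Lemma vertices_many : G <= 2 ^+ n * p.
Proof.
have h : 1 <= 2 ^+ n * q ^+ n.
  by rewrite -exprMn exprn_ege1 //; have := q_ge_half; lra.
have t0 : 0 <= 2 ^+ n :> R by rewrite exprn_ge0.
apply: le_trans (ler_wpM2l t0 pG).
by rewrite mulrCA ler_peMr // ltW.
Qed.

(** By the threshold identity, the sum of [2 ^ n * 'C(n, d) * r ^ (d - delta n)]
over [d] equals [q ^ (- 2 n)]. The factor [n + 1] is the price of keeping one
largest term of the sum, and 8 bounds [r ^ delta], the price of rounding [d]. *)
Lemma far_pairs_many (d : nat) : d%:R <= n.+1%:R * delta ->
  (1 + r) ^+ n <= n.+1%:R * ('C(n, d)%:R * r ^+ d) ->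
  G ^+ 2 <= 8 * n.+1%:R * (2 ^+ n * 'C(n, d)%:R * p ^+ 2).
Proof.
move=> dle peak.
have r1 := ratio_gt1 hdelta hH.
have r0 : 0 < r by lra.
set B := r `^ (- delta); have B0 : 0 < B by apply: powR_gt0.
have rB : r ^+ d * B ^+ n.+1 <= 1.
  rewrite -powR_mulrn ?(ltW r0) // -powR_mulrn ?powR_ge0 // -powRrM -powRD; last first.
    by rewrite (gt_eqF r0) implybT.
  rewrite -[leRHS](powRr0 r); apply: ler_powR; first exact: ltW.
  by rewrite mulNr subr_le0 mulrC.
have id1 : 1 = 2 ^+ n * (1 + r) ^+ n * q ^+ n ^+ 2 * B ^+ n.
  by rewrite (exprAC _ n 2) -!exprMn /B (threshold_identity hdelta hH) expr1n.
have c0 : 0 <= 'C(n, d)%:R :> R by [].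
have h1 : 1 <= 8 * n.+1%:R * (2 ^+ n * 'C(n, d)%:R * q ^+ n ^+ 2).
  have B8 : 1 <= 8 * B by have := ratio_powR_ge; rewrite -/B; lra.
  have w0 : 0 <= 2 ^+ n * q ^+ n ^+ 2 * B ^+ n by rewrite !mulr_ge0 ?exprn_ge0 // ltW.
  have := ler_wpM2l w0 peak; set v := 2 ^+ n * q ^+ n ^+ 2.
  set V := 8 * n.+1%:R * (2 ^+ n * 'C(n, d)%:R * q ^+ n ^+ 2).
  have V0 : 0 <= V by rewrite !mulr_ge0 ?exprn_ge0 // ltW.
  move=> h; rewrite id1.
  have -> : 2 ^+ n * (1 + r) ^+ n * q ^+ n ^+ 2 * B ^+ n = v * B ^+ n * (1 + r) ^+ n.
    by rewrite /v; ring.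
  apply: (le_trans h).
  apply: (@le_trans _ _ (v * B ^+ n * (n.+1%:R * ('C(n, d)%:R * r ^+ d)) * (8 * B))).
    by rewrite ler_peMr // !mulr_ge0 ?exprn_ge0 // ltW.
  have -> : v * B ^+ n * (n.+1%:R * ('C(n, d)%:R * r ^+ d)) * (8 * B) =
            V * (r ^+ d * B ^+ n.+1) by rewrite exprSr /V /v; ring.
  by rewrite -[leRHS]mulr1 ler_wpM2l.
have h2 : G ^+ 2 * q ^+ n ^+ 2 <= p ^+ 2.
  by rewrite -exprMn lerXn2r // nnegrE ?mulr_ge0 ?exprn_ge0 // ltW.
apply: (@le_trans _ _ (8 * n.+1%:R * (2 ^+ n * 'C(n, d)%:R * (G ^+ 2 * q ^+ n ^+ 2)))).
  have -> : 8 * n.+1%:R * (2 ^+ n * 'C(n, d)%:R * (G ^+ 2 * q ^+ n ^+ 2)) =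
    G ^+ 2 * (8 * n.+1%:R * (2 ^+ n * 'C(n, d)%:R * q ^+ n ^+ 2)) by ring.
  by rewrite ler_peMr // exprn_ge0 // ltW.
by rewrite ler_wpM2l ?mulr_ge0 // ler_wpM2l // mulr_ge0 // exprn_ge0.
Qed.

Lemma subcube_many (d : nat) : n.+1%:R * delta - 1 <= d%:R -> G <= 2 * (p * 2 ^+ d).
Proof.
move=> dge.
have h : 2^-1 <= q ^+ n * 2 ^+ d.
  rewrite -[2^-1]powR_inv1 // -powR_mulrn ?(ltW q0) // -[2 ^+ d]powR_mulrn //.
  rewrite -powRrM -powRD; last by rewrite pnatr_eq0 implybT.
  apply: ler_powR; first lra.
  by move: dge hdelta; rewrite -[n.+1%:R]natr1; lra.
have := ler_wpM2l (ltW G_gt0) h.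
have t0 : 0 <= 2 ^+ d :> R by rewrite exprn_ge0.
have := ler_wpM2r t0 pG; lra.
Qed.

Lemma avoid_cap (d k : nat) : n.+1%:R * delta - 1 <= d%:R -> (2 ^ d <= 2 * k + 4)%N ->
  (1 - p) ^+ k <= expR (2 - G / 4).
Proof.
move=> dge; rewrite -(ler_nat R) natrX natrD natrM => dk.
apply: (@le_trans _ _ (expR (- p) ^+ k)).
  rewrite lerXn2r // ?nnegrE ?expR_ge0 ?subr_ge0 //.
  exact: expR_ge1Dx.
rewrite -expRM_natl ler_expR.
have := ler_wpM2l (ltW p_gt0) dk; have := subcube_many dge; move: p1.
lra.
Qed.

(** The number of configurations is at most [2 ^ ((n + 1) ^ 2 + 2 n)], and [G / 4]
exceeds its logarithm by at least [n + 2]. *)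
Lemma union_small :
  2 ^+ n * 2 ^+ n * (2 ^+ n + 1) ^+ n.+1 * expR (2 - G / 4) <= n.+1%:R^-1.
Proof.
have two k : 2 ^+ k <= expR (k%:R) :> R.
  rewrite -[k%:R]mulr1 expRM_natl lerXn2r ?nnegrE ?expR_ge0 //.
  by have := expR_ge1Dx (1 : R); lra.
have h1 : (2 ^+ n + 1) ^+ n.+1 <= 2 ^+ (n.+1 * n.+1) :> R.
  rewrite exprM lerXn2r ?nnegrE ?addr_ge0 ?exprn_ge0 // exprS.
  have : 1 <= 2 ^+ n :> R by apply: exprn_ege1; rewrite ler1n.
  lra.
have h2 : 2 ^+ n * 2 ^+ n * (2 ^+ n + 1) ^+ n.+1 <= expR ((n + n + n.+1 * n.+1)%N%:R) :> R.
  apply: le_trans (two _); rewrite -exprD [leRHS]exprD.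
  by rewrite ler_wpM2l // exprn_ge0.
apply: (le_trans (ler_wpM2r (expR_ge0 _) h2)).
rewrite -expRD; apply: (@le_trans _ _ (expR (- n%:R))).
  rewrite ler_expR !natrD natrM -[n.+1%:R]natr1.
  by move: large; rewrite cubeE; move: x0 x2 x3; lra.
rewrite expRN lef_pV2 ?posrE ?expR_gt0 // -[n.+1%:R]natr1 addrC.
exact: expR_ge1Dx.
Qed.

(** A clique either has no pair at distance [d], or has an adjacent one. *)
Lemma Pr_clique_le : Pr p [set A : {set cube n} | is_clique R A] <= 21 * n.+1%:R^-1.
Proof.
have hp : 0 <= p <= 1 by rewrite p1 ltW.
have [d [dn dge dle peak]] := binomial_peak n.
have d0 : (0 < d)%N.
  have n1 : 1 <= x by rewrite (ler_nat R 1).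
  rewrite -(ltr_nat R); apply: lt_le_trans dge.
  by move: hdelta; rewrite -[n.+1%:R]natr1; nra.
pose nofar := [set A : {set cube n} | forall y z, y \in A -> z \in A -> #|diff y z| != d].
pose adj := [set A : {set cube n} | exists y z, #|diff y z| = d /\ skeleton_adj R A y z].
apply: (@le_trans _ _ (Pr p nofar + Pr p adj)).
  rewrite !PrE -ExD; apply: Ex_le => // A.
  have [cl|ncl] := pselect (is_clique R A); last by rewrite asboolF // addr_ge0.
  rewrite asboolT //.
  have [nf|far] := pselect (nofar A); first by rewrite (asboolT nf) lerDl.
  rewrite (asboolF far) add0r asboolT //.
  move/existsNP: far => [y /existsNP[z]].
  move=> /not_implyP[yA /not_implyP[zA /negP]]; rewrite negbK => /eqP dyz.
  exists y, z; split=> //; apply: cl => //.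
  by rewrite -diff_eq0 -cards_eq0 dyz -lt0n.
have G3 : n.+1%:R <= G.
  apply: le_trans large.
  have h : n.+1%:R <= 8 * (x + 3) ^+ 3 by rewrite cubeE -[n.+1%:R]natr1; move: x0 x2 x3; lra.
  exact: h.
have n10 : 0 < n.+1%:R :> R by [].
have b1 : 4 / (2 ^+ n * p) <= 4 * n.+1%:R^-1.
  rewrite ler_wpM2l // lef_pV2 ?posrE ?mulr_gt0 ?exprn_gt0 //.
  exact: le_trans G3 vertices_many.
have b2 : 2 / (2 ^+ n * 'C(n, d)%:R * p ^+ 2) <= 16 * n.+1%:R^-1.
  have w0 : 0 < 2 ^+ n * 'C(n, d)%:R * p ^+ 2 by rewrite !mulr_gt0 ?exprn_gt0 // ltr0n bin_gt0.
  rewrite ler_pdivrMr // mulrAC ler_pdivlMr //.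
  have := far_pairs_many dle peak; rewrite -mulrA => h.
  have h' : n.+1%:R ^+ 2 <= G ^+ 2 by rewrite lerXn2r // nnegrE ltW.
  have := le_trans h' h; rewrite expr2 mulrCA ler_pM2l // => {}h.
  lra.
have b3 : Pr p adj <= n.+1%:R^-1.
  apply: le_trans union_small; apply: (Pr_far_adj hp) => [k|]; last exact: expR_ge0.
  exact: avoid_cap.
have nf := le_trans (Pr_no_far_pair hp d0 p_gt0 dn) (lerD b1 b2).
have e21 (i : R) : 4 * i + 16 * i + i = 21 * i by ring.
by apply: (le_trans (lerD nf b3)); rewrite e21.
Qed.

End LargeDimension.
End Supercritical.

Theorem theorem1p6 (R : realType) (eps delta : R)
    (heps : 0 < eps)
    (hdelta : 1 / 2 < delta <= 1)
    (hH : entropy delta = 2 * delta - 1)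
    (p : nat -> R)
    (hp : forall n : nat, (1 <= n)%N -> 0 <= p n <= 1) :
  ((forall n : nat, (1 <= n)%N -> p n <= ((1 - eps) * 2 `^ (- delta)) ^+ n) ->
   Pr (p n) [set A : {set cube n} | is_clique R A] @[n --> \oo] --> (1 : R))
  /\
  ((forall n : nat, (1 <= n)%N -> ((1 + eps) * 2 `^ (- delta)) ^+ n <= p n) ->
   Pr (p n) [set A : {set cube n} | ~ is_clique R A] @[n --> \oo] --> (1 : R)).
Proof.
have q0 := q_gt0 delta; set q := 2 `^ (- delta) in q0 *.
split=> pq.
  (* For [eps > 1] the hypothesis is contradictory at [n = 1]. *)
  have a0 : 0 <= 1 - eps.
    have /andP[p1 _] := hp 1%N isT.
    by have := le_trans p1 (pq 1%N isT); rewrite expr1 pmulr_lge0.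
  have b0 : 0 <= 6 * q ^+ 4 by rewrite mulr_ge0 // exprn_ge0 // ltW.
  have lim : 1 - (((1 - eps) ^+ 2) ^+ n + (6 * q ^+ 4) ^+ n) @[n --> \oo] --> (1 : R).
    rewrite -[X in _ --> X]subr0 -[X in _ --> _ - X]addr0.
    apply: cvgB; first exact: cvg_cst.
    apply: cvgD; apply: cvg_expr.
      rewrite ger0_norm ?exprn_ge0 // expr_lt1 //; lra.
    by rewrite ger0_norm // q4_lt.
  refine (squeeze_cvgr _ lim (@cvg_cst _ (1 : R) _ _ _)).
  near=> n.
  have n1 : (1 <= n)%N by near: n; exact: nbhs_infty_gt.
  rewrite (Pr_le1 (hp n n1)) andbT lerBlDr -lerBlDl -Pr_setC.
  apply: (le_trans (Pr_nonclique (hp n n1))).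
  apply: first_moment_le => //; first by rewrite a0 /= gerBl ltW.
  by have /andP[-> _] := hp n n1; exact: pq.
have [N hN] := growth heps.
have lim : 1 - 21 * harmonic n @[n --> \oo] --> (1 : R).
  rewrite -[X in _ --> X]subr0 -[X in _ --> _ - X](mulr0 21).
  apply: cvgB; first exact: cvg_cst.
  by apply: cvgM; [exact: cvg_cst|exact: cvg_harmonic].
refine (squeeze_cvgr _ lim (@cvg_cst _ (1 : R) _ _ _)).
near=> n.
have n1 : (1 <= n)%N by near: n; exact: nbhs_infty_gt.
have Nn : (N <= n)%N by near: n; exact: nbhs_infty_ge.
rewrite (Pr_le1 (hp n n1)) andbT.
rewrite (Pr_setC (p n) [set A : {set cube n} | is_clique R A]) lerB //.
have /andP[_ p1] := hp n n1.
apply: (Pr_clique_le hdelta hH n1 p1 _ (hN n Nn)).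
by rewrite -exprMn; exact: pq.
Unshelve. all: by end_near.
Qed.
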